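(* For every integer $n\geq0$, $$\sum_{k=0}^{n}(-1)^{k}{2n+1\brack 2k}(-q;q)_{2n-2k}\, T_{2k+1}(q)=\sum_{k=0}^{n} (-1)^{k} {2n+1\brack 2k}q^{2k} S_{2k}(q).$$ Equivalently, $\sum_{k=0}^{n}(-1)^{k}{2n+1\brack 2k}\bigl((-q;q)_{2n-2k} T_{2k+1}(q)-q^{2k} S_{2k}(q)\bigr)=0$.
   Context: For a nonnegative integer $m$, $(t;q)_m=\prod_{i=0}^{m-1}(1-tq^i)$; in particular $(-q;q)_m=(1+q)(1+q^2)\cdots(1+q^m)$. The $q$-binomial coefficient is ${m\brack j}=\frac{(q;q)_m}{(q;q)_{m-j}(q;q)_j}$ for $0\le j\le m$. The inversion number $\mathsf{inv}(\pi)$ of a permutation $\pi$ is the number of pairs $i<j$ with $\pi_i>\pi_j$. The $q$-tangent numbers $T_{2m+1}(q)$ are defined by $\frac{\sin_q(x)}{\cos_q(x)}=\sum_{m\geq0}T_{2m+1}(q)\frac{x^{2m+1}}{(q;q)_{2m+1}}$, where $\sin_q(x)=\sum_{m\geq0}(-1)^m\frac{x^{2m+1}}{(q;q)_{2m+1}}$ and $\cos_q(x)=\sum_{m\geq0}(-1)^m\frac{x^{2m}}{(q;q)_{2m}}$ (equivalently, $T_{2m+1}(q)=\sum q^{\mathsf{inv}(\pi)}$ over down-up permutations $\pi_1>\pi_2<\pi_3>\cdots$ of $[2m+1]$). The $q$-secant numbers are $S_0(q)=1$ and, for $m\ge1$, $S_{2m}(q)=\sum_{\pi}q^{\mathsf{inv}(\pi)}$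 summed over all up-down permutations $\pi_1<\pi_2>\pi_3<\cdots$ of $[2m]$. *)

(* Defs.v *)
From HB Require Import structures.
From mathcomp Require Import all_boot all_order all_algebra perm fingroup.

Set Implicit Arguments.
Unset Strict Implicit.
Unset Printing Implicit Defensive.

Import GRing.Theory.
Local Open Scope ring_scope.

Section FormalPowerSeries.
Variable F : fieldType.

(* A formal power series in x over F is its coefficient sequence nat -> F. *)
Definition fps_mul (f g : nat -> F) (n : nat) : F :=
  \sum_(i < n.+1) f i * g (n - i)%N.

(* The first n coefficients of f / g, by long division; meaningful when
   g 0 != 0, see fps_divK. *)
Fixpoint fps_div_prefix (f g : nat -> F) (n : nat) : seq F :=
  if n is m.+1 then
    let s := fps_div_prefix f g m in
    rcons s ((f m - \sum_(i < m) s`_i * g (m - i)%N) / g 0%N)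
  else [::].

Definition fps_div (f g : nat -> F) (n : nat) : F :=
  (fps_div_prefix f g n.+1)`_n.

Lemma size_fps_div_prefix f g n : size (fps_div_prefix f g n) = n.
Proof. by elim: n => //= n IHn; rewrite size_rcons IHn. Qed.

Lemma nth_fps_div_prefix f g n i :
  (i < n)%N -> (fps_div_prefix f g n)`_i = fps_div f g i.
Proof.
elim: n => // n IHn; rewrite ltnS leq_eqVlt => /predU1P[-> //|lt_in].
by rewrite /= nth_rcons size_fps_div_prefix lt_in IHn.
Qed.

Lemma fps_divE f g n :
  fps_div f g n = (f n - \sum_(i < n) fps_div f g i * g (n - i)%N) / g 0%N.
Proof.
rewrite {1}/fps_div /= nth_rcons size_fps_div_prefix ltnn eqxx.
by under eq_bigr => i _ do rewrite nth_fps_div_prefix //.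
Qed.

Lemma fps_divK f g : g 0%N != 0 -> fps_mul (fps_div f g) g =1 f.
Proof.
move=> g0 n; rewrite /fps_mul big_ord_recr /= subnn [fps_div _ _ n]fps_divE.
by rewrite divfK // addrC subrK.
Qed.

End FormalPowerSeries.

Section QSeries.
Variables (F : fieldType) (q : F).

(* (t; q)_m *)
Definition qpoch (t : F) (m : nat) : F := \prod_(i < m) (1 - t * q ^+ i).

(* Only meant for j <= m. *)
Definition qbinom (m j : nat) : F :=
  qpoch q m / (qpoch q (m - j) * qpoch q j).

Definition qsin (n : nat) : F :=
  if odd n then (-1) ^+ n./2 / qpoch q n else 0.

Definition qcos (n : nat) : F :=
  if odd n then 0 else (-1) ^+ n./2 / qpoch q n.

(* qtangent m is T_{2m+1}(q) *)
Definition qtangent (m : nat) : F :=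
  fps_div qsin qcos (2 * m).+1 * qpoch q (2 * m).+1.

Definition inv_num (n : nat) (s : 'S_n) : nat :=
  #|[set p : 'I_n * 'I_n | (p.1 < p.2)%N && (s p.2 < s p.1)%N]|.

(* s_1 < s_2 > s_3 < ... : positions are numbered from 0 here, so the
   ascents are at the even positions. *)
Definition up_down (n : nat) (s : 'S_n) : bool :=
  [forall i : 'I_n, forall j : 'I_n, (j == i.+1 :> nat) ==>
     (if odd i then (s j < s i)%N else (s i < s j)%N)].

(* qsecant m is S_{2m}(q); the value S_0(q) = 1 is qsecant0. *)
Definition qsecant (m : nat) : F :=
  \sum_(s : 'S_(2 * m) | up_down s) q ^+ inv_num s.

Lemma qsecant0 : qsecant 0 = 1.
Proof.
rewrite /qsecant (big_pred1 1%g) => [|s].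
  rewrite /inv_num; set A := finset _.
  suff -> : A = set0 by rewrite cards0 expr0.
  by apply/setP => -[[]].
have -> : s = 1%g by apply/permP => -[].
by rewrite /= eqxx; apply/forallP => -[].
Qed.

Lemma qpoch_neq0 n : (forall i, q ^+ i.+1 != 1) -> qpoch q n != 0.
Proof.
move=> hq; apply/prodf_neq0 => i _.
by rewrite -exprS subr_eq0 eq_sym.
Qed.

Lemma qcos0 : qcos 0 = 1.
Proof. by rewrite /qcos /qpoch big_ord0 divr1. Qed.

Lemma fps_div_qsin_qcos_even n : ~~ odd n -> fps_div qsin qcos n = 0.
Proof.
elim/ltn_ind: n => n IHn even_n.
rewrite fps_divE {1}/qsin (negbTE even_n) big1 ?subrr ?mul0r // => i _.
case: (boolP (odd i)) => odd_i; last by rewrite IHn ?mul0r.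
by rewrite /qcos oddB ?(ltnW (ltn_ord i)) // (negbTE even_n) odd_i mulr0.
Qed.

(* sin_q / cos_q = \sum_m T_{2m+1}(q) x^(2m+1) / (q; q)_{2m+1} *)
Lemma qtangent_series : (forall i, q ^+ i.+1 != 1) ->
  fps_div qsin qcos =1
    fun n => if odd n then qtangent n./2 / qpoch q n else 0.
Proof.
move=> hq n; case: ifP => [odd_n|/negbT/fps_div_qsin_qcos_even //].
have -> : qtangent n./2 = fps_div qsin qcos n * qpoch q n.
  by rewrite /qtangent mul2n -[in RHS](odd_double_half n) odd_n.
by rewrite mulfK // qpoch_neq0.
Qed.

Lemma qtangent_seriesM : (forall i, q ^+ i.+1 != 1) ->
  fps_mul (fun n => if odd n then qtangent n./2 / qpoch q n else 0) qcos
    =1 qsin.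
Proof.
move=> hq n; rewrite -[RHS](@fps_divK F qsin qcos) ?qcos0 ?oner_eq0 //.
by apply: eq_bigr => i _; rewrite -qtangent_series.
Qed.

End QSeries.

(* The indeterminate q of the field Q(q) of rational functions. *)
Definition qvar : {fraction {poly rat}} := tofrac 'X.

Lemma qvarX_neq1 i : qvar ^+ i.+1 != 1.
Proof.
rewrite /qvar -tofracXn -tofrac1 tofrac_eq -subr_eq0 -size_poly_eq0.
by rewrite size_XnsubC.
Qed.

(* Main.v *)
(* Replacing x by i x turns the q-trigonometric series into
   e(x) = \sum x^n/(q;q)_n and its even and odd parts C = cosh_q, S = sinh_q,
   and the two sides of the theorem become coefficients of A B and of
   S(x) / C(qx), where A is the q-derivative of S/C and
   B = \sum (-q;q)_{2m} x^{2m+1} / (q;q)_{2m+1}.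
   The relation e(qx) = (1-x) e(x) gives C(qx) = C - xS and S(qx) = S - xC,
   hence A C(x) C(qx) = C^2 - S^2 = e(x) e(-x), while the q-binomial theorem
   gives B e(x) e(-x) = S C; so A B C(qx) = S.
   That 1/C generates the q-secant numbers is seen by building permutations
   from left to right, keeping track only of the relative rank of the last
   value: permutations which alternate and then increase are counted by a
   q-binomial times a secant number, and splitting them by the step where the
   increasing run starts makes the alternating sum telescope. *)
Require Import Defs.
From HB Require Import structures.
From mathcomp Require Import all_boot all_order all_algebra.
From mathcomp Require Import perm fingroup boolp functions ring zify.

Set Implicit Arguments.
Unset Strict Implicit.
Unset Printing Implicit Defensive.

Import GRing.Theory.
Local Open Scope ring_scope.

(** * The ring of formal power series *)

(** A separate name for [nat -> F], on which the product is the Cauchy product. *)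
Definition series (F : fieldType) : Type := nat -> F.

Section SeriesRing.
Variable F : fieldType.
Implicit Types f g h : series F.

HB.instance Definition _ := GRing.Zmodule.copy (series F) (nat -> F).

Let trunc n f : {poly F} := \poly_(i < n.+1) f i.

Let coef_trunc n f i : (i <= n)%N -> (trunc n f)`_i = f i.
Proof. by move=> le_in; rewrite coef_poly ltnS le_in. Qed.

(** A coefficient of a product involves only coefficients of at most the same order, so the ring
    laws can be read off from truncations to polynomials. *)
Lemma fps_mul_coef n f g (P Q : {poly F}) :
    (forall i, (i <= n)%N -> P`_i = f i) ->
    (forall i, (i <= n)%N -> Q`_i = g i) ->
  fps_mul f g n = (P * Q)`_n.
Proof.
move=> Pf Qg; rewrite coefM; apply: eq_bigr => i _.
by rewrite Pf ?Qg ?leq_subr // -ltnS.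
Qed.

Let fps_mul_trunc n f g i : (i <= n)%N ->
  fps_mul f g i = (trunc n f * trunc n g)`_i.
Proof.
by move=> le_in; apply: fps_mul_coef => j le_ji; rewrite coef_trunc //;
  apply: leq_trans le_in.
Qed.

Lemma fps_mulC : commutative (@fps_mul F : series F -> series F -> series F).
Proof.
by move=> f g; apply/funext => n; rewrite !(@fps_mul_trunc n) // mulrC.
Qed.

Lemma fps_mulA : associative (@fps_mul F : series F -> series F -> series F).
Proof.
move=> f g h; apply/funext => n.
rewrite (@fps_mul_coef n f _ (trunc n f) (trunc n g * trunc n h)).
- rewrite (@fps_mul_coef n _ h (trunc n f * trunc n g) (trunc n h)) ?mulrA //.
    by move=> i le_in; rewrite (@fps_mul_trunc n).
  exact: coef_trunc.
- exact: coef_trunc.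
- by move=> i le_in; rewrite (@fps_mul_trunc n).
Qed.

Definition series1 : series F := fun n => (n == 0)%:R.

Lemma fps_mul1 :
  left_id series1 (@fps_mul F : series F -> series F -> series F).
Proof.
move=> f; apply/funext => n; rewrite /fps_mul big_ord_recl mul1r subn0.
by rewrite big1 ?addr0 // => i _; rewrite mul0r.
Qed.

Lemma fps_mulDl :
  left_distributive (@fps_mul F : series F -> series F -> series F) +%R.
Proof.
move=> f g h; apply/funext => n.
have -> : (fps_mul f h + fps_mul g h) n = fps_mul f h n + fps_mul g h n by [].
by rewrite /fps_mul -big_split; apply: eq_bigr => i _; apply: mulrDl.
Qed.

Lemma series1_neq0 : series1 != 0.
Proof. by apply/eqP => /(congr1 (@^~ 0%N)) /eqP; rewrite oner_eq0. Qed.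

HB.instance Definition _ := GRing.Zmodule_isComNzRing.Build (series F)
  fps_mulA fps_mulC fps_mul1 fps_mulDl series1_neq0.

Lemma seriesM f g n : (f * g) n = \sum_(i < n.+1) f i * g (n - i)%N.
Proof. by []. Qed.

Lemma seriesD f g n : (f + g) n = f n + g n.
Proof. by []. Qed.

Lemma seriesB f g n : (f - g) n = f n - g n.
Proof. by []. Qed.

Lemma series_mulI f g h : f 0 != 0 -> f * g = f * h -> g = h.
Proof.
move=> f0 fgh; pose e : series F := fps_div (1 : series F) f.
have ef1 : e * f = 1 by apply/funext => n; exact: fps_divK.
by rewrite -[g]mul1r -ef1 -mulrA fgh mulrA ef1 mul1r.
Qed.

Definition seriesX : series F := fun n => (n == 1)%:R.

Lemma seriesXM f n : (seriesX * f) n = if n is m.+1 then f m else 0.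
Proof.
rewrite seriesM big_ord_recl mul0r add0r; case: n => [|n].
  by rewrite big_ord0.
rewrite big_ord_recl mul1r subSS subn0 big1 ?addr0 // => i _.
by rewrite mul0r.
Qed.

Lemma seriesX_mulI f g : seriesX * f = seriesX * g -> f = g.
Proof.
move=> fg; apply/funext => n.
by have := congr1 (@^~ n.+1) fg; rewrite !seriesXM.
Qed.

(* The substitution x := c x. *)
Definition dilate (c : F) f : series F := fun n => c ^+ n * f n.

Lemma dilateM c f g : dilate c (f * g) = dilate c f * dilate c g.
Proof.
apply/funext => n; rewrite /dilate !seriesM mulr_sumr; apply: eq_bigr => i _.
by rewrite mulrACA -exprD subnKC // -ltnS.
Qed.

End SeriesRing.

(** * q-exponentials *)

Section QExponential.
Variables (F : fieldType) (q : F).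
Hypothesis hq : forall i, q ^+ i.+1 != 1.
Hypothesis two_neq0 : (2 : F) != 0.

Local Notation X := (seriesX F).
Local Notation "f ^q" := (dilate q f) (at level 2, format "f ^q").
Local Notation "f ^-" := (dilate (-1) f) (at level 2, format "f ^-").

Lemma qpochS t m : qpoch q t m.+1 = qpoch q t m * (1 - t * q ^+ m).
Proof. by rewrite /qpoch big_ord_recr. Qed.

Lemma qpoch0 t : qpoch q t 0 = 1.
Proof. by rewrite /qpoch big_ord0. Qed.

Lemma qfact_neq0 n : qpoch q q n != 0.
Proof. exact: qpoch_neq0. Qed.

Lemma one_sub_exp_neq0 n : 1 - q ^+ n.+1 != 0.
Proof. by rewrite subr_eq0 eq_sym. Qed.

Lemma qfactS n : qpoch q q n.+1 = qpoch q q n * (1 - q ^+ n.+1).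
Proof. by rewrite qpochS exprS. Qed.

Definition qexp : series F := fun n => (qpoch q q n)^-1.
Definition qcosh : series F := fun n => if odd n then 0 else (qpoch q q n)^-1.
Definition qsinh : series F := fun n => if odd n then (qpoch q q n)^-1 else 0.

Lemma qexp_dilate : qexp^q = (1 - X) * qexp.
Proof.
apply/funext => -[|n]; rewrite mulrBl mul1r seriesB seriesXM /dilate /qexp.
  by rewrite expr0 mul1r subr0.
rewrite qfactS; field.
by rewrite one_sub_exp_neq0 qfact_neq0.
Qed.

Lemma qexpE : qexp = qcosh + qsinh.
Proof.
by apply/funext => n; rewrite seriesD /qexp /qcosh /qsinh; case: odd;
  rewrite ?addr0 ?add0r.
Qed.

Lemma qexpNE : qexp^- = qcosh - qsinh.
Proof.
apply/funext => n; rewrite seriesB /dilate /qexp /qcosh /qsinh -signr_odd.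
by case: odd; rewrite ?subr0 ?sub0r ?expr1 ?expr0 ?mulN1r ?mul1r.
Qed.

Lemma qcosh_dilate : qcosh^q = qcosh - X * qsinh.
Proof.
apply/funext => -[|n]; rewrite seriesB seriesXM /dilate /qcosh /qsinh /=.
  by rewrite expr0 mul1r subr0.
case: odd => /=; rewrite ?qfactS; last by rewrite mulr0 subr0.
field; by rewrite one_sub_exp_neq0 qfact_neq0.
Qed.

Lemma qsinh_dilate : qsinh^q = qsinh - X * qcosh.
Proof.
apply/funext => -[|n]; rewrite seriesB seriesXM /dilate /qcosh /qsinh /=.
  by rewrite mulr0 subr0.
case: odd => /=; rewrite ?qfactS; first by rewrite mulr0 subr0.
field; by rewrite one_sub_exp_neq0 qfact_neq0.
Qed.

(* (-x; q)_oo / (x; q)_oo, by the q-binomial theorem. *)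
Definition qratio : series F := fun n => qpoch q (-1) n / qpoch q q n.

Lemma qratio_dilate : (1 + X) * qratio^q = (1 - X) * qratio.
Proof.
apply/funext => -[|n]; rewrite mulrDl mulrBl !mul1r seriesB seriesD !seriesXM.
  by rewrite /dilate addr0 subr0 mul1r.
rewrite /dilate /qratio qfactS qpochS mulN1r opprK; field.
by rewrite one_sub_exp_neq0 qfact_neq0.
Qed.

(** Both sides satisfy [h(qx) = (1-x) h(x)] with constant term 1. As [1 - q^(n+1)] is nonzero, this
    fixes each coefficient from the previous one. *)
Lemma qratioE : qratio * qexp^- = qexp.
Proof.
pose h := qratio * qexp^-.
have hN : qexp^-^q = (1 + X) * qexp^-.
  have -> : qexp^-^q = qexp^q^-.
    by apply/funext => n; rewrite /dilate mulrCA.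
  rewrite qexp_dilate dilateM; congr (_ * _); apply/funext => -[|[|n]];
    rewrite /dilate seriesB seriesD ?subr0 ?addr0 /= ?mul1r //.
    by rewrite /seriesX /= expr1 sub0r mulrNN mul1r add0r.
  exact: mulr0.
have hq1 : h^q = (1 - X) * h.
  rewrite dilateM hN mulrCA mulrA.
  by rewrite qratio_dilate /h mulrA.
apply/funext => n; rewrite -/h; elim: n => [|n IHn].
  rewrite /h seriesM big_ord1 /qratio /dilate /qexp !qpoch0.
  by rewrite expr0 !invr1 !mulr1.
have := congr1 (@^~ n.+1) hq1; rewrite mulrBl mul1r seriesB seriesXM /dilate.
rewrite IHn /qexp qfactS => hE.
apply: (mulfI (one_sub_exp_neq0 n)); rewrite mulrBl mul1r hE.
field; by rewrite one_sub_exp_neq0 qfact_neq0.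
Qed.

Lemma qpochN1S m : qpoch q (-1) m.+1 = 2 * qpoch q (- q) m.
Proof.
rewrite /qpoch big_ord_recl expr0 mulr1 opprK; congr (_ * _).
by apply: eq_bigr => i _; rewrite exprS mulN1r mulNr.
Qed.

(* Half the odd part of [qratio]. *)
Definition qhalf : series F :=
  fun n => if odd n then qpoch q (- q) n.-1 / qpoch q q n else 0.

(** With [r] for [qratio], [r(x) e(-x) = e(x)] and [r(-x) e(x) = e(-x)], so four times the left side
    is [e(x)^2 - e(-x)^2 = 4 C S]. *)
Lemma qhalfE : qhalf * (qexp * qexp^-) = qcosh * qsinh.
Proof.
have rN : qratio^- * qexp = qexp^-.
  rewrite -[X in _ = dilate _ X]qratioE dilateM; congr (_ * _).
  by apply/funext => n; rewrite /dilate mulrA -exprMn mulrNN mulr1 expr1n mul1r.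
have h4 : 4 * qhalf = qratio - qratio^-.
  apply/funext => n; rewrite [4 * _]mulr_natl seriesB.
  have -> : (qhalf *+ 4) n = qhalf n *+ 4 by rewrite !mulrS mulr0n !seriesD.
  rewrite /dilate /qratio /qhalf.
  rewrite -signr_odd.
  case: n => [|n]; first by rewrite /= mul0rn expr0 mul1r subrr.
  case: ifP => _ /=; last by rewrite mul0rn expr0 mul1r subrr.
  by rewrite qpochN1S -mulr_natl; ring.
apply: (@series_mulI F 4).
  have -> : (4 : series F) 0 = 4.
    by rewrite !mulrS mulr0n !seriesD.
  by rewrite (natrM _ 2 2) mulf_neq0.
have -> : 4 * (qhalf * (qexp * qexp^-)) =
   (qratio * qexp^-) * qexp - (qratio^- * qexp) * qexp^-.
  by rewrite mulrA h4; ring.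
by rewrite qratioE rN qexpNE qexpE; ring.
Qed.

(* [dth] is the q-derivative of [th = tanh_q]. *)
Lemma qtanh_derivative (th dth sech : series F) :
    th * qcosh = qsinh -> X * dth = th - th^q -> sech * qcosh = 1 ->
  dth * qhalf = sech^q * qsinh.
Proof.
move=> thE dthE sechE.
have C0 : qcosh 0 != 0 by rewrite /qcosh /= invr_eq0 qfact_neq0.
have Cq0 : qcosh^q 0 != 0 by rewrite /dilate expr0 mul1r.
have dE : dth * qcosh * qcosh^q = qexp * qexp^-.
  (* After multiplication by [x] the claim is [S C(qx) - S(qx) C = x (C^2 - S^2)]. *)
  apply: seriesX_mulI.
  transitivity ((X * dth) * qcosh * qcosh^q); first by ring.
  rewrite dthE.
  transitivity ((th * qcosh) * qcosh^q - (th^q * qcosh^q) * qcosh).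
    by ring.
  rewrite -dilateM thE qcosh_dilate qsinh_dilate qexpNE qexpE; ring.
have sqE : sech^q * qcosh^q = 1.
  rewrite -dilateM sechE; apply/funext => -[|n]; rewrite /dilate ?mul1r //.
  by rewrite mulr0.
apply: (series_mulI Cq0); rewrite [RHS]mulrA [_ * sech^q]mulrC sqE mul1r.
apply: (series_mulI C0).
rewrite -qhalfE -dE; ring.
Qed.
End QExponential.

(** * Secant numbers *)

Lemma inv_num_sum n (s : 'S_n) :
  inv_num s = (\sum_(i < n) \sum_(j < n) ((i < j) && (s j < s i)))%N.
Proof.
rewrite /inv_num cardsE -sum1_card pair_big /= [RHS]big_mkcond /= big_mkcond.
by apply: eq_bigr => p _; rewrite unfold_in; case: (_ && _).
Qed.

Lemma ltn_bump2 h i j : (bump h i < bump h j)%N = (i < j)%N.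
Proof. by rewrite !ltnNge leq_bump2. Qed.

Lemma widen_ord_lift n (i : 'I_n) : widen_ord (leqnSn n) i = lift ord_max i.
Proof. by apply/val_inj; rewrite /= /bump leqNgt ltn_ord. Qed.

(** Appending the last value [j] raises the old values [>= j] by one, which keeps their relative
    order; exactly these [n - j] letters form new inversions. *)
Lemma inv_num_lift n (j : 'I_n.+1) (s : 'S_n) :
  inv_num (lift_perm ord_max j s) = (inv_num s + (n - j))%N.
Proof.
rewrite !inv_num_sum big_ord_recr /= [X in (_ + X)%N]big1 ?addn0; last first.
  by move=> i _; rewrite ltnNge -ltnS ltn_ord.
have -> : (n - j = \sum_(i < n) (j <= s i))%N.
  rewrite -(reindex_inj (@perm_inj _ s)
    (P := predT) (F := fun i : 'I_n => nat_of_bool (j <= i)%N)).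
  rewrite -(big_mkord predT (fun i => nat_of_bool (j <= i)%N)).
  rewrite (@big_cat_nat _ _ _ j) ?leq0n //=; last by rewrite -ltnS ltn_ord.
  rewrite big_nat big1 => [|i /andP[_ lt_ij]]; last by rewrite leqNgt lt_ij.
  rewrite big_nat (eq_bigr (fun=> 1%N)) => [|i /andP[-> //]].
  by rewrite -big_nat sum_nat_const_nat muln1.
rewrite -big_split; apply: eq_bigr => i _; rewrite big_ord_recr /=.
rewrite !widen_ord_lift lift_perm_id lift_perm_lift ltn_ord /=; congr (_ + _)%N.
  apply: eq_bigr => k _.
  by rewrite !widen_ord_lift !lift_perm_lift /= ltn_bump2.
by rewrite /bump; case: leqP => //= lt; rewrite ?add1n ?ltnS ?add0n; lia.
Qed.

(** Only the step from position [n] to [n.+1] is new. A descent reads [j <= s ord_max] because the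
    old last value is then raised above [j]. *)
Lemma up_down_lift n (j : 'I_n.+2) (s : 'S_n.+1) :
  up_down (lift_perm ord_max j s) =
  up_down s && (if odd n then j <= s ord_max else s ord_max < j)%N.
Proof.
apply/forallP/andP => [ud|[/forallP ud lk]].
  split.
    apply/forallP => i; apply/forallP => k; apply/implyP => ik.
    have /forallP /(_ (lift ord_max k)) := ud (lift ord_max i).
    rewrite -!widen_ord_lift /= ik /= !widen_ord_lift !lift_perm_lift /=.
    by rewrite !ltn_bump2.
  have /forallP /(_ ord_max) := ud (lift ord_max ord_max).
  rewrite {1 2}/lift /= /bump ltnn add0n eqxx /= lift_perm_id lift_perm_lift /=.
  by rewrite /bump; case: odd; case: leqP; lia.
move=> i; apply/forallP => k; apply/implyP => /eqP ik.
case: (unliftP ord_max i) => [i'|] Ei; last first.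
  by move: (ltn_ord k); rewrite ik Ei /= ltnn.
rewrite Ei -widen_ord_lift /= widen_ord_lift lift_perm_lift.
have {}ik : k = i'.+1 :> nat by rewrite ik Ei -widen_ord_lift.
case: (unliftP ord_max k) => [k'|] Ek; rewrite Ek.
  rewrite !lift_perm_lift /= !ltn_bump2.
  have /forallP /(_ k') := ud i' => /implyP; apply.
  by move: ik; rewrite Ek -widen_ord_lift /= => ->.
have -> : i' = ord_max by apply: val_inj; move: ik; rewrite Ek /= => -[].
rewrite lift_perm_id /=.
by move: lk; rewrite /bump; case: odd; case: leqP; lia.
Qed.

Lemma reindex_lift_perm (R : nmodType) n (j : 'I_n.+1) (P : pred 'S_n.+1)
    (f : 'S_n.+1 -> R) :
  \sum_(s | P s && (s ord_max == j)) f s =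
  \sum_(s : 'S_n | P (lift_perm ord_max j s)) f (lift_perm ord_max j s).
Proof.
pose ext (p : 'I_n.+1 * 'S_n) := lift_perm ord_max p.1 p.2.
have ext_inj : injective ext.
  move=> [j1 s1] [j2 s2]; rewrite /ext /= => eq_ext.
  have eq_j : j1 = j2.
    by rewrite -(lift_perm_id ord_max j1 s1) eq_ext lift_perm_id.
  rewrite -{j2}eq_j in eq_ext *; congr pair; apply/permP => i.
  by apply: (@lift_inj _ j1); rewrite -!(lift_perm_lift ord_max) eq_ext.
(* Surjectivity comes from counting: [(n+1) * n! = (n+1)!]. *)
have [|h extK hK] := inj_card_bij ext_inj.
  by rewrite card_prod card_ord !card_Sn factS.
rewrite (reindex (lift_perm ord_max j)); last first.
  exists (fun s => (h s).2) => [s _|s].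
    by rewrite -[lift_perm _ _ _]/(ext (j, s)) extK.
  rewrite inE => /andP[_ /eqP <-].
  have -> : s ord_max = (h s).1 by rewrite -{1}(hK s) lift_perm_id.
  exact: hK.
by apply: eq_bigl => s; rewrite lift_perm_id eqxx andbT.
Qed.

(** * Weights refined by the last value, and q-binomials *)

Section Secant.
Variables (F : fieldType) (q : F).

(* [f i] is the weight of a family of permutations of [n] letters with last
   value [i]; appending a last value [j] creates [n - j] inversions, and [up]
   (resp. [down]) keeps those permutations where the appended step is an
   ascent (resp. a descent). *)
Definition up n (f : nat -> F) j := q ^+ (n - j) * \sum_(i < j) f i.
Definition down n (f : nat -> F) j := q ^+ (n - j) * \sum_(j <= i < n) f i.

(** The index is the last position, so [up_down_weight n] concerns permutations of [n.+1]
    letters. *)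
Fixpoint up_down_weight n : nat -> F :=
  if n is m.+1 then
    (if odd m then down else up) m.+1 (up_down_weight m)
  else fun=> 1.

Lemma up_down_weightP n (j : 'I_n.+1) :
  \sum_(s : 'S_n.+1 | up_down s && (s ord_max == j)) q ^+ inv_num s =
  up_down_weight n j.
Proof.
elim: n j => [|n IHn] j.
  rewrite (big_pred1 1%g) => [|s].
    rewrite /inv_num; set A := finset _.
    suff -> : A = set0 by rewrite cards0 expr0.
    by apply/setP => -[a b]; rewrite !inE !ord1.
  have -> : s = 1%g by apply/permP => i; rewrite !ord1.
  rewrite /= eqxx perm1 !ord1 eqxx andbT; apply/forallP => a.
  by apply/forallP => b; rewrite !ord1.
rewrite reindex_lift_perm.
transitivity (q ^+ (n.+1 - j) *
    \sum_(i < n.+1 | (if odd n then j <= i else i < j)%N) up_down_weight n i).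
  transitivity (\sum_(s : 'S_n.+1 | up_down s &&
       (if odd n then j <= s ord_max else s ord_max < j)%N)
       q ^+ (n.+1 - j) * q ^+ inv_num s).
    apply: eq_big => [s|s _]; first by rewrite up_down_lift.
    by rewrite inv_num_lift exprD mulrC.
  rewrite -big_distrr /=; congr (_ * _).
  rewrite (partition_big (fun s : 'S_n.+1 => s ord_max)
     (fun i : 'I_n.+1 => if odd n then j <= i else i < j)%N) => [|s /andP[]//].
  apply: eq_bigr => i lk; rewrite -IHn; apply: eq_bigl => s.
  by case: eqP => [->|_]; rewrite ?andbF // lk !andbT.
rewrite /=; case: (odd n); rewrite /down /up; congr (_ * _).
  by rewrite big_geq_mkord.
by rewrite (big_ord_widen n.+1 (up_down_weight n)) // -ltnS.
Qed.

Lemma sum_up_down n :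
  \sum_(s : 'S_n.+1 | up_down s) q ^+ inv_num s =
  \sum_(j < n.+1) up_down_weight n j.
Proof.
rewrite (partition_big (fun s : 'S_n.+1 => s ord_max) predT) //=.
by apply: eq_bigr => j _; rewrite up_down_weightP.
Qed.

(* Unlike [qbinom], this vanishes when [n < b]. *)
Fixpoint qbin n b : F :=
  match n, b with
  | _, 0 => 1
  | 0, _.+1 => 0
  | m.+1, c.+1 => qbin m c + q ^+ c.+1 * qbin m c.+1
  end.

Lemma qbin0r n : qbin n 0 = 1.
Proof. by case: n. Qed.

Lemma qbin_small n b : (n < b)%N -> qbin n b = 0.
Proof.
elim: n b => [|n IHn] [|b] //; rewrite ltnS => lt_nb.
by rewrite /= !IHn ?(ltnW lt_nb) ?mulr0 ?addr0 // ltnS ltnW.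
Qed.

Lemma qbinnn n : qbin n n = 1.
Proof. by elim: n => //= n ->; rewrite qbin_small // mulr0 addr0. Qed.

(** The hockey-stick identity, from iterating the Pascal rule; it evaluates a sum over the last
    value before an ascent. *)
Lemma qbin_hockey n b :
  \sum_(j < n) q ^+ (b.+1 * (n.-1 - j)) * qbin j b = qbin n b.+1.
Proof.
elim: n => [|n IHn]; first by rewrite big_ord0.
rewrite big_ord_recr /= subnn muln0 expr0 mul1r addrC -IHn mulr_sumr.
congr (_ + _); apply: eq_bigr => i _; rewrite mulrA -exprD.
by congr (q ^+ _ * _); have := ltn_ord i; nia.
Qed.

Section QBinom.
Hypothesis hq : forall i, q ^+ i.+1 != 1.

Lemma qbinM a b :
  qbin (a + b) b * (qpoch q q a * qpoch q q b) = qpoch q q (a + b).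
Proof.
elim: a b => [|a IHa] b; first by rewrite add0n qbinnn qpoch0 !mul1r.
elim: b => [|b IHb]; first by rewrite addn0 qbin0r qpoch0 mul1r mulr1.
have := IHa b.+1; rewrite addSnnS in IHb; rewrite addSn.
have qm : q ^+ (a + b.+1).+1 = q ^+ a.+1 * q ^+ b.+1 by rewrite -exprD.
move: (a + b.+1)%N IHb qm => m IHb qm IHab; rewrite [RHS]qfactS qm.
(* Mirrors [1 - uv = (1 - v) + v (1 - u)] with [u = q^(a+1)] and [v = q^(b+1)]. *)
transitivity ((1 - q ^+ b.+1) * (qbin m b * (qpoch q q a.+1 * qpoch q q b))
  + q ^+ b.+1 * (1 - q ^+ a.+1) *
  (qbin m b.+1 * (qpoch q q a * qpoch q q b.+1))).
  by rewrite /= !qfactS; ring.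
by rewrite IHb IHab; ring.
Qed.

Lemma qbinomE m j : (j <= m)%N -> qbinom q m j = qbin m j.
Proof.
move=> le_jm; rewrite /qbinom -[in X in X / _](subnK le_jm) -qbinM subnK //.
by rewrite mulfK // mulf_neq0 // qpoch_neq0.
Qed.
End QBinom.

(** * Appended increasing runs and the telescoping sum *)

Fixpoint ups n f b : nat -> F :=
  if b is c.+1 then up (n + c) (ups n f c) else f.

Lemma upsSS n f b : ups n.+2 (up n.+1 (up n f)) b = ups n f b.+2.
Proof.
elim: b => [|b IHb]; first by rewrite /= addn0 addn1.
by rewrite [LHS]/= IHb !addSn -!addnS.
Qed.

Lemma eq_ups n f g b : (forall j, (j < n)%N -> f j = g j) ->
  forall j, (j < n + b)%N -> ups n f b j = ups n g b j.
Proof.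
move=> fg; elim: b => [|b IHb] j; first by rewrite addn0; apply: fg.
rewrite addnS ltnS => le_j; congr (_ * _); apply: eq_bigr => i _.
by apply: IHb; apply: leq_trans le_j.
Qed.

Lemma upsD n f g b j :
  ups n (fun i => f i + g i) b j = ups n f b j + ups n g b j.
Proof.
elim: b j => [//|b IHb] j /=; rewrite /up -mulrDr -big_split.
by congr (_ * _); apply: eq_bigr => i _; rewrite IHb.
Qed.

(** When the appended step may go either way, the new last value is free and [f] enters only through
    its total weight. *)
Lemma up_down_sum n f j : (j <= n)%N ->
  down n f j + up n f j = q ^+ (n - j) * \sum_(i < n) f i.
Proof.
move=> le_jn; rewrite -mulrDr addrC; congr (_ * _).
by rewrite -!(big_mkord predT) -big_cat_nat.
Qed.

Lemma ups_geometric n t b j : (j <= n + b)%N ->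
  ups n.+1 (fun i => q ^+ (n - i) * t) b j =
  q ^+ (b.+1 * (n + b - j)) * qbin j b * t.
Proof.
elim: b j => [|b IHb] j le_j.
  by rewrite /= addn0 mul1n qbin0r mulr1.
rewrite /= /up -qbin_hockey !mulr_sumr mulr_suml; apply: eq_bigr => i _.
have lt_ij := ltn_ord i.
rewrite IHb; last by rewrite addnS in le_j; lia.
by rewrite !mulrA -!exprD; congr (q ^+ _ * _ * _); nia.
Qed.

(** A free letter followed by [b] ascents is an increasing run of [b.+1] letters; the q-binomial
    counts the choices of its set of values. *)
Lemma sum_ups_geometric n t b :
  \sum_(j < n.+1 + b) ups n.+1 (fun i => q ^+ (n - i) * t) b j =
  qbin (n.+1 + b) b.+1 * t.
Proof.
rewrite -qbin_hockey mulr_suml; apply: eq_bigr => j _.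
by rewrite ups_geometric // -ltnS -addSn.
Qed.

(* The weight of the permutations of [2 a + 1 + b] letters which alternate up
   to position [2 a + 1], with a descent just before it, and increase from
   there on. *)
Definition alt_then_up a b :=
  \sum_(j < (2 * a).+1 + b) ups (2 * a).+1 (up_down_weight (2 * a)) b j.

Lemma alt_then_up0 b : alt_then_up 0 b = 1.
Proof.
transitivity (qbin (1 + b) b.+1 * 1); last by rewrite mulr1 add1n qbinnn.
rewrite -sum_ups_geometric.
apply: eq_bigr => j _; apply: eq_ups => [i i_lt|]; last exact: ltn_ord.
by rewrite sub0n expr0 mulr1.
Qed.

Lemma qsecantS a :
  qsecant q a.+1 = \sum_(j < (2 * a).+2) up_down_weight (2 * a).+1 j.
Proof. by rewrite -sum_up_down /qsecant mulnS. Qed.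

Lemma qsecantS_alt a : qsecant q a.+1 = alt_then_up a 1.
Proof.
by rewrite qsecantS /alt_then_up addn1 /= addn0 mul2n odd_double.
Qed.

(** Append a free letter and then [b] ascents to an up-down permutation of [2a+2] letters. If the
    free step descends, the alternating part grows; if it ascends, the run starts at position [2a+1]
    and has [b+2] ascents. *)
Lemma alt_then_up_step a b :
  alt_then_up a.+1 b + alt_then_up a b.+2 =
  qbin ((2 * a.+1).+1 + b) b.+1 * qsecant q a.+1.
Proof.
rewrite qsecantS -sum_ups_geometric /alt_then_up.
have -> : ((2 * a).+1 + b.+2 = (2 * a.+1).+1 + b)%N by lia.
rewrite -big_split; apply: eq_bigr => -[j lt_j] _; rewrite [nat_of_ord _]/=.
have e2 : (2 * a.+1 = (2 * a).+2)%N by lia.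
have e3 : up_down_weight (2 * a.+1) =
    down (2 * a.+1) (up_down_weight (2 * a).+1).
  by rewrite e2 /= mul2n odd_double.
rewrite e3.
have -> : ups (2 * a).+1 (up_down_weight (2 * a)) b.+2 j =
  ups (2 * a.+1).+1 (up (2 * a.+1) (up_down_weight (2 * a).+1)) b j.
  by rewrite -upsSS mulnS /= mul2n odd_double.
rewrite [LHS]/= -upsD; apply: eq_ups lt_j => i lt_i.
by rewrite up_down_sum // mulnS.
Qed.

(** Telescopes by [alt_then_up_step]; the induction on [a] trades a unit of [c] for one of [a],
    keeping the top index fixed. *)
Lemma sum_qbin_secant_lt a c :
  \sum_(i < a.+1) (-1) ^+ i * qbin (2 * (a + c).+1) (2 * (a + c).+1 - 2 * i)
    * qsecant q i = (-1) ^+ a * alt_then_up a (2 * c).+1.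
Proof.
elim: a c => [|a IHa] c.
  by rewrite big_ord1 muln0 subn0 qbinnn qsecant0 alt_then_up0 !mulr1.
rewrite addSnnS big_ord_recr IHa -addSnnS [nat_of_ord _]/=.
have -> : (2 * (a.+1 + c).+1 = (2 * a.+1).+1 + (2 * c).+1)%N by lia.
have -> : ((2 * a.+1).+1 + (2 * c).+1 - 2 * a.+1 = (2 * c).+2)%N by lia.
rewrite -mulrA -alt_then_up_step exprS.
rewrite (_ : (2 * c.+1).+1 = (2 * c).+3)%N; last by lia.
by rewrite -[LHS]/(_ + _); ring.
Qed.

Lemma sum_qbin_secant m :
  \sum_(i < m.+2) (-1) ^+ i * qbin (2 * m.+1) (2 * m.+1 - 2 * i)
    * qsecant q i = 0.
Proof.
rewrite big_ord_recr [nat_of_ord _]/= subnn qbin0r mulr1 qsecantS_alt.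
have := sum_qbin_secant_lt m 0; rewrite addn0 muln0 => ->.
by rewrite -[LHS]/(_ + _) exprS; ring.
Qed.

End Secant.

(** * The generating function identity *)

(** The boolean treats even and odd orders together: for [b = true] the extra top term has an odd
    index in [f] and vanishes. *)
Lemma seriesM_even (F : fieldType) (f g : series F) n (b : bool) :
    (forall i, odd i -> f i = 0) ->
  (f * g) (2 * n + b)%N = \sum_(k < n.+1) f (2 * k)%N * g (2 * n + b - 2 * k)%N.
Proof.
move=> f0; rewrite seriesM.
have -> : \sum_(i < (2 * n + b).+1) f i * g (2 * n + b - i)%N =
    \sum_(i < (2 * n).+1) f i * g (2 * n + b - i)%N.
  case: b; last by rewrite addn0.
  have f0n : f (2 * n).+1 = 0 by rewrite f0 //= oddM.
  by rewrite addn1 big_ord_recr /= f0n mul0r addr0.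
move: (2 * n + b)%N => m.
elim: n => [|n IHn]; first by rewrite !big_ord1.
rewrite [RHS]big_ord_recr -IHn mulnS big_ord_recr; congr (_ + _).
by rewrite big_ord_recr /= f0 ?mul0r ?addr0 // mul2n /= odd_double.
Qed.

(** * Hyperbolic secant and tangent series *)

Section Hyperbolic.
Variables (F : fieldType) (q : F).
Hypothesis hq : forall i, q ^+ i.+1 != 1.

Definition qsech : series F :=
  fun i => if odd i then 0 else (-1) ^+ i./2 * qsecant q i./2 / qpoch q q i.

Definition qtanh : series F :=
  fun i => if odd i then (-1) ^+ i./2 * qtangent q i./2 / qpoch q q i else 0.

(** The q-derivative [(th(x) - th(qx)) / x]: the factor [1 - q^(i+1)] lowers [(q;q)_(i+1)] to
    [(q;q)_i]. *)
Definition dqtanh : series F :=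
  fun i => if odd i then 0 else (-1) ^+ i./2 * qtangent q i./2 / qpoch q q i.

Lemma qsechE : qsech * qcosh q = 1.
Proof.
apply/funext => n; have [odd_n|even_n] := boolP (odd n).
  rewrite seriesM big1 => [|i _]; first by case: n odd_n.
  rewrite /qsech /qcosh oddB ?odd_n -1?ltnS //.
  by case: odd; rewrite ?mul0r ?mulr0.
have -> : n = (2 * n./2 + false)%N by lia.
rewrite seriesM_even => [|i odd_i]; last by rewrite /qsech odd_i.
rewrite addn0.
case: {even_n}(n./2) => [|m].
  by rewrite big_ord1 /qsech /qcosh /= qsecant0 qpoch0 !(mul1r, divr1).
(* The zero is replaced by the vanishing secant sum, to be matched term by term. *)
transitivity (0 / qpoch q q (2 * m.+1)); last by rewrite mul0r.
rewrite -[X in _ = X / _](sum_qbin_secant q m) mulr_suml; apply: eq_bigr => i _.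
have le_i : (2 * i <= 2 * m.+1)%N by have := ltn_ord i; lia.
rewrite -qbinomE ?leq_subr // /qbinom subKn //.
rewrite /qsech /qcosh oddB // !oddM /= (_ : (2 * i)./2 = i); last by lia.
by field; rewrite !qpoch_neq0.
Qed.

Lemma qtanhE : qtanh * qcosh q = qsinh q.
Proof.
apply/funext => n; rewrite seriesM; have [odd_n|even_n] := boolP (odd n).
  have -> : qsinh q n = (-1) ^+ n./2 * qsin q n.
    rewrite /qsinh /qsin odd_n mulrA -exprD addnn -mul2n exprM.
    by rewrite sqrrN expr1n expr1n mul1r.
  rewrite -qtangent_seriesM // mulr_sumr; apply: eq_bigr => i _.
  have le_i : (i <= n)%N by rewrite -ltnS.
  rewrite /qtanh /qcosh /qcos oddB // odd_n.
  case: (boolP (odd i)) => [odd_i|]; last by rewrite !mul0r mulr0.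
  (* The halves add up since [i] is odd and [n - i] even; the sign from [qcos] then occurs
     squared. *)
  have -> : (n./2 = i./2 + (n - i)./2)%N by lia.
  rewrite exprD /=.
  transitivity ((-1) ^+ i./2 * (qtangent q i./2 / qpoch q q i) *
     (((-1) ^+ (n - i)./2) ^+ 2 / qpoch q q (n - i))).
    by rewrite sqrr_sign mul1r !mulrA.
  by ring.
rewrite /qsinh (negbTE even_n) big1 // => i _.
rewrite /qtanh /qcosh oddB ?(negbTE even_n) -1?ltnS //.
by case: odd; rewrite ?mul0r ?mulr0.
Qed.

Lemma dqtanhE : seriesX F * dqtanh = qtanh - dilate q qtanh.
Proof.
apply/funext => -[|n]; rewrite seriesB seriesXM /dilate /qtanh.
  by rewrite /= mulr0 subr0.
rewrite /dqtanh /=; case: (boolP (odd n)) => [_|even_n] /=.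
  by rewrite mulr0 subr0.
rewrite uphalf_half (negbTE even_n) add0n qfactS; field.
by rewrite one_sub_exp_neq0 // qpoch_neq0.
Qed.

Lemma sum_qtangent_qsecant n : (2 : F) != 0 ->
  \sum_(k < n.+1) (-1) ^+ k * qbinom q (2 * n + 1) (2 * k)
      * qpoch q (- q) (2 * n - 2 * k) * qtangent q k
  = \sum_(k < n.+1) (-1) ^+ k * qbinom q (2 * n + 1) (2 * k)
      * q ^+ (2 * k) * qsecant q k.
Proof.
move=> two_neq0.
have eqn : (dqtanh * qhalf q) (2 * n + true)%N =
    (dilate q qsech * qsinh q) (2 * n + true)%N.
  by rewrite (qtanh_derivative hq two_neq0 qtanhE dqtanhE qsechE).
rewrite !seriesM_even in eqn; first last.
- by move=> i odd_i; rewrite /dqtanh odd_i.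
- by move=> i odd_i; rewrite /dilate /qsech odd_i mulr0.
have N0 : qpoch q q (2 * n + 1) != 0 by rewrite qpoch_neq0.
(* Each side is [(q;q)_(2n+1)] times the coefficient of [x^(2n+1)] in [eqn]. *)
transitivity (qpoch q q (2 * n + 1) *
  \sum_(k < n.+1) dqtanh (2 * k)%N * qhalf q (2 * n + true - 2 * k)%N);
  last rewrite eqn; rewrite mulr_sumr; apply: eq_bigr => k _;
  rewrite /qbinom ?/dqtanh ?/qhalf ?/dilate ?/qsech ?/qsinh;
  have le_k : (2 * k <= 2 * n)%N by have := ltn_ord k; lia.
all: have -> : (2 * n + true - 2 * k = (2 * n - 2 * k).+1)%N by lia.
all: have -> : odd (2 * k) = false by rewrite oddM.
all: have -> : odd (2 * n - 2 * k).+1 by lia.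
all: rewrite (_ : (2 * k)./2 = k); last by lia.
all: field; by rewrite !qpoch_neq0.
Qed.
End Hyperbolic.

Theorem theorem4p5 (n : nat) :
  \sum_(k < n.+1) (-1) ^+ k * qbinom qvar (2 * n + 1) (2 * k)
      * qpoch qvar (- qvar) (2 * n - 2 * k) * qtangent qvar k
  = \sum_(k < n.+1) (-1) ^+ k * qbinom qvar (2 * n + 1) (2 * k)
      * qvar ^+ (2 * k) * qsecant qvar k.
Proof.
apply: sum_qtangent_qsecant qvarX_neq1 _ _.
(* What remains is that 2 is nonzero in the field of rational functions. *)
rewrite -(rmorph_nat (@tofrac {poly rat})) tofrac_eq0.
by rewrite -polyC_natr polyC_eq0.
Qed.
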